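(* Let $q$ be a power of a prime $p$, let $\xi\in\mathbb F_{q^2}\setminus\mathbb F_q$, and let $k$ be an integer with $3\le k\le q+1$. (i) If $p=2$ and $k=5$, then $\widetilde{\mathcal B}_{W_5^{\mathrm{Luc}}}=\{T\subseteq U_{q+1}:|T|=5,\ e_2(T)=0\}$. (ii) If $p$ is odd and $k=2p-3$, then $\widetilde{\mathcal B}_{W_{2p-3}^{\mathrm{Luc}}}=\{T\subseteq U_{q+1}:|T|=2p-3,\ e_{p-2}(T)=0\}$. (iii) If $p$ is odd and $k=2p-2$, then $\widetilde{\mathcal B}_{W_{2p-2}^{\mathrm{Luc}}}=\{T\subseteq U_{q+1}:|T|=2p-2,\ e_{p-1}(T)=0\}$. (iv) If $p$ is odd and $k=3p-2$, then $\widetilde{\mathcal B}_{W_{3p-2}^{\mathrm{Luc}}}=\{T\subseteq U_{q+1}:|T|=3p-2,\ e_{p-1}(T)=0\}$.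
   Context: For nonnegative integers $i,k$ with base-$p$ expansions $i=\sum_r i_rp^r$, $k=\sum_r k_rp^r$ ($0\le i_r,k_r\le p-1$), write $i\le_p k$ if $i_r\le k_r$ for all $r$. $\mathbb F_q[X,Y]_k$ is the space of homogeneous polynomials of degree $k$ over $\mathbb F_q$. The Lucas subspace is $W_k^{\mathrm{Luc}}=\mathrm{span}_{\mathbb F_q}\{X^{k-i}Y^i:0\le i\le k,\ i\le_p k\}\subseteq\mathbb F_q[X,Y]_k$. $\mathbb P^1(\mathbb F_q)=\mathbb F_q\cup\{\infty\}$. For a $k$-subset $S\subseteq\mathbb P^1(\mathbb F_q)$, $F_S(X,Y)=\prod_{t\in S}(X-tY)$, where the factor for $t=\infty$ is taken to be $Y$. For a subspace $W\subseteq\mathbb F_q[X,Y]_k$, $\mathcal B_W=\{S\subseteq\mathbb P^1(\mathbb F_q): |S|=k,\ F_S\in W\}$. $U_{q+1}=\{u\in\mathbb F_{q^2}^\times:u^{q+1}=1\}$. The Cayley transform is the bijection $\kappa:\mathbb P^1(\mathbb F_q)\to U_{q+1}$, $\kappa(x)=\frac{x-\xi}{x-\xi^q}$ for $x\in\mathbb F_q$, $\kappa(\infty)=1$, and $\widetilde{\mathcal B}_{W}=\{\kappa(S):S\in\mathcal B_{W}\}$. For a finite set $T$ of field elements, $e_a(T)$ is the $a$-th elementary symmetric polynomial of its elements. *)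

(* Defs.v *)
From HB Require Import structures.
From mathcomp Require Import all_boot all_order all_algebra all_field.
From mathcomp Require Export mpoly.

Set Implicit Arguments.
Unset Strict Implicit.
Unset Printing Implicit Defensive.

Import GRing.Theory.
Local Open Scope ring_scope.

Definition digit (p i r : nat) : nat := ((i %/ p ^ r) %% p)%N.

(* The digits of i of rank r >= i vanish, so bounding r by i loses nothing
   when p > 1: see lucas_leP. *)
Definition lucas_le (p i k : nat) : bool :=
  [forall r : 'I_i, digit p i r <= digit p k r]%N.

Lemma lucas_leP (p i k : nat) : (1 < p)%N ->
  reflect (forall r : nat, digit p i r <= digit p k r)%N (lucas_le p i k).
Proof.
move=> p_gt1; apply: (iffP forallP) => [le_ik r | le_ik r]; last exact: le_ik.
have [lt_ri | le_ir] := ltnP r i; first exact: (le_ik (Ordinal lt_ri)).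
have lt_i : (i < p ^ r)%N := leq_ltn_trans le_ir (ltn_expl r p_gt1).
by rewrite [digit p i r]/digit (divn_small lt_i) mod0n.
Qed.

Section Homogeneous.
Variable F : finFieldType.

Definition varX : {mpoly F[2]} := 'X_(inord 0).
Definition varY : {mpoly F[2]} := 'X_(inord 1).

Lemma mvar_homog (j : 'I_2) : ('X_j : {mpoly F[2]}) \is 1.-homog.
Proof. by rewrite dhomogX; apply/eqP/mdeg1. Qed.

Definition monXY (k i : nat) : {mpoly F[2]} := varX ^+ (k - i) * varY ^+ i.

Lemma monXY_homog (k i : nat) : (i <= k)%N -> monXY k i \is k.-homog.
Proof.
move=> le_ik.
have homogXn j n : ('X_j : {mpoly F[2]}) ^+ n \is n.-homog.
  by rewrite -[n in n.-homog]mul1n; apply/dhomogMn/mvar_homog.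
have := dhomogM (homogXn (inord 0) (k - i)%N) (homogXn (inord 1) i).
by rewrite subnK.
Qed.

(* dhomog 2 F k is F[X,Y]_k; as an element of it, ['dhomog_k p] is p
   whenever p is homogeneous of degree k (and 0, a value never used below,
   otherwise): see monXY_homog and set_form_homog. *)
Definition lucas_space (p k : nat) : {vspace dhomog 2 F k} :=
  <<[seq ['dhomog_k (monXY k i)] | i <- iota 0 k.+1 & lucas_le p i k]>>%VS.

(* P^1(F) is option F, with None the point at infinity. *)
Definition point_form (t : option F) : {mpoly F[2]} :=
  if t is Some a then varX - a *: varY else varY.

Definition set_form (S : {set option F}) : {mpoly F[2]} :=
  \prod_(t in S) point_form t.

Lemma set_form_homog (S : {set option F}) : set_form S \is #|S|.-homog.
Proof.
rewrite /set_form -sum1_card.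
apply: (big_ind2 (fun f d => f \is d.-homog)) => [|f d g e|t _].
- exact: dhomog1.
- exact: dhomogM.
case: t => [a|]; last exact: mvar_homog.
by apply: rpredB; rewrite ?rpredZ // mvar_homog.
Qed.

Definition blocks (k : nat) (W : {vspace dhomog 2 F k}) : {set {set option F}} :=
  [set S : {set option F} | (#|S| == k) && (['dhomog_k (set_form S)] \in W)].

End Homogeneous.

Section Cayley.
Variables (F L : finFieldType) (emb : {rmorphism F -> L}) (xi : L).

Definition cayley (x : option F) : L :=
  if x is Some a then (emb a - xi) / (emb a - xi ^+ #|F|) else 1.

Definition cayley_blocks (k : nat) (W : {vspace dhomog 2 F k}) :
    {set {set L}} :=
  [set cayley @: S | S : {set option F} in blocks W].

End Cayley.

Definition unity_set (L : finFieldType) (n : nat) : {set L} :=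
  [set u : L | (u != 0) && (u ^+ n == 1)].

Definition elem_sym (L : finFieldType) (a : nat) (T : {set L}) : L :=
  (mesym #|T| L a).@[fun i : 'I_#|T| => enum_val i].

(* Main.v *)
(* The Lucas space is stable under every linear substitution: over k = k'p + k0
   and i = i'p + i0, the product l1^(k-i) l2^i of linear forms is
   (l1^p)^(k'-i') (l2^p)^i' times l1^(k0-i0) l2^i0, and l1^p, l2^p are linear
   forms in X^p, Y^p. The Cayley transform is induced by a linear substitution
   over L, so S is a block iff the form with root set T = kappa(S) is in the
   Lucas space over L, i.e. iff e_j(T) = 0 for all j not below k. In each of the
   four cases only a and k - a are missing, and e_(k-a)(T) = e_k(T) e_a(T)^q
   because u^q = 1/u on U_(q+1). *)
Require Import Defs.
From mathcomp Require Import all_boot all_order all_algebra all_field.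
From mathcomp Require Import zify ring.

Set Implicit Arguments.
Unset Strict Implicit.
Unset Printing Implicit Defensive.

Import GRing.Theory.
Local Open Scope ring_scope.

(** * Base-[p] digits and their behaviour under powers of linear polynomials *)

Lemma lucas_le_rec (p i k : nat) : (1 < p)%N ->
  lucas_le p i k =
  (i %% p <= k %% p)%N && lucas_le p (i %/ p)%N (k %/ p)%N.
Proof.
move=> p_gt1; apply/(lucas_leP _ _ p_gt1)/andP => [le_ik | [le0 le_ik] [|r]].
- split; first by have := le_ik 0%N; rewrite /digit expn0 !divn1.
  apply/(lucas_leP _ _ p_gt1) => r.
  by have := le_ik r.+1; rewrite /digit expnS !divnMA.
- by rewrite /digit expn0 !divn1.
move/(lucas_leP _ _ p_gt1)/(_ r): le_ik.
by rewrite /digit expnS !divnMA.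
Qed.

Lemma lucas_le_small (p i k : nat) : (1 < p)%N -> (i < p)%N -> (k < p)%N ->
  lucas_le p i k = (i <= k)%N.
Proof.
move=> p_gt1 lt_ip lt_kp; rewrite lucas_le_rec // !modn_small // !divn_small //.
by rewrite [lucas_le p 0 0](introT (lucas_leP _ _ p_gt1)) ?andbT // => r.
Qed.

Lemma lucas_le_leq (p i k : nat) : (1 < p)%N -> lucas_le p i k -> (i <= k)%N.
Proof.
move=> p_gt1; elim/ltn_ind: i k => i IH k.
have [->|i_gt0] := posnP i; first by [].
rewrite lucas_le_rec // => /andP[le0 /IH le1].
rewrite (divn_eq i p) (divn_eq k p) leq_add // leq_mul2r le1 ?orbT //.
by rewrite ltn_Pdiv.
Qed.

(** Strong induction on [k]: Frobenius turns the upper digits into a polynomial in [X^p], and the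
    last digits give a factor of degree at most [k %% p < p], so no carry mixes the two. *)
Lemma linear_powers_lucas (p : nat) (L : fieldType) :
    p \in [pchar L] -> forall (k i : nat), lucas_le p i k ->
  forall (a b c d : L) (j : nat), ~~ lucas_le p j k ->
  ((a%:P + b *: 'X) ^+ (k - i) * (c%:P + d *: 'X) ^+ i)`_j = 0.
Proof.
move=> pL; have p_pr : prime p := pcharf_prime pL.
have p_gt1 := prime_gt1 p_pr; have p_gt0 := prime_gt0 p_pr.
have frob (a b : L) n :
    (a%:P + b *: 'X) ^+ (n * p) = ((a ^+ p)%:P + (b ^+ p) *: 'X) ^+ n \Po 'X^p.
  rewrite mulnC exprM exprDn_pchar; last first.
    by rewrite pnatE // pchar_poly.
  rewrite rmorphXn /= rmorphD /= comp_polyC comp_polyZ comp_polyX.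
  by rewrite exprZn polyC_exp.
elim/ltn_ind => k IH i le_ik a b c d j nle_jk.
have := le_ik; rewrite lucas_le_rec // => /andP[le_ik0 le_ik1].
have le_ik1' := lucas_le_leq p_gt1 le_ik1.
have [k0|k_gt0] := posnP k.
  have i0 : i = 0%N by apply/eqP; rewrite -leqn0 -k0 (lucas_le_leq p_gt1).
  rewrite k0 i0 !expr0 mulr1 coef1; case: eqP nle_jk => // ->.
  by rewrite k0 lucas_le_small.
(* The subtraction is borrow-free because [i] is digitwise below [k]. *)
have -> : (k - i = (k %/ p - i %/ p) * p + (k %% p - i %% p))%N.
  have := leq_mul le_ik1' (leqnn p); rewrite mulnBl.
  by move: (divn_eq k p) (divn_eq i p) le_ik0; lia.
rewrite [in X in _ * X](divn_eq i p) !exprD !frob mulrACA -comp_polyM.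
set R := _ ^+ (k %% p - i %% p) * _; set A := (X in X \Po _).
have size_lin (u v : L) n : (size ((u%:P + v *: 'X) ^+ n)%R <= n.+1)%N.
  apply: leq_trans (size_poly_exp_leq _ _) _; rewrite ltnS.
  have : (size (u%:P + v *: 'X)%R <= 2)%N.
    apply: leq_trans (size_polyD _ _) _; rewrite geq_max.
    rewrite (leq_trans (size_polyC_leq1 _)) //.
    by rewrite (leq_trans (size_scale_leq _ _)) ?size_polyX.
  by case: (size _) => [|[|[|]]] //= _; rewrite ?mul0n ?mul1n.
have sizeR : (size R <= (k %% p).+1)%N.
  rewrite (leq_trans (size_polyMleq _ _)) // -subn1 leq_subLR.
  by rewrite (leq_trans (leq_add (size_lin _ _ _) (size_lin _ _ _))) //; lia.
rewrite coefM big1 // => [[s /= lt_sj] _].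
rewrite coef_comp_poly_Xn //; case: ifP => [/dvdnP[t def_s]|]; last by rewrite mul0r.
have [le_R|lt_R] := ltnP (k %% p)%N (j - s)%N.
  by rewrite [R`__]nth_default ?mulr0 // (leq_trans sizeR).
(* Here [s = t * p] and [j - s <= k %% p < p], so [t] and [j - s] are the quotient and last digit of
   [j]; since [j] is not below [k], the failure lies in [t] against [k %/ p]. *)
rewrite def_s mulnK // [A`_t]IH ?mul0r //; first by rewrite ltn_Pdiv.
have lt_kp : (k %% p < p)%N by rewrite ltn_mod.
have def_j : j = (t * p + (j - s))%N by rewrite -def_s subnKC.
have lt_rp : (j - s < p)%N by apply: leq_ltn_trans lt_kp.
apply: contra nle_jk => le_t; rewrite lucas_le_rec // def_j.
by rewrite modnMDl modn_small // lt_R divnMDl // divn_small // addn0.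
Qed.

(** * Binary forms: coefficients, the Lucas space, linear substitution *)

Definition expXY (k i : nat) : 'X_{1..2} :=
  (U_(inord 0) *+ (k - i) + U_(inord 1) *+ i)%MM.

Lemma expXYE (k i : nat) (j : 'I_2) :
  expXY k i j = if j == 0 :> nat then (k - i)%N else i.
Proof.
rewrite /expXY mnmDE !mulmnE !mnm1E.
have e (n : nat) : (n < 2)%N -> (inord n == j) = (n == j :> nat).
  by move=> lt_n2; rewrite -val_eqE /= inordK.
rewrite !e //; case: j {e} => [[|[|]]] //= _.
  by rewrite mul1n mul0n addn0.
by rewrite mul1n mul0n.
Qed.

Lemma mdeg2 (m : 'X_{1..2}) : mdeg m = (m (inord 0) + m (inord 1))%N.
Proof.
rewrite mdegE big_ord_recl big_ord1.
by congr (m _ + m _)%N; apply/val_inj; rewrite /= inordK.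
Qed.

Lemma mdeg_expXY (k i : nat) : (i <= k)%N -> mdeg (expXY k i) = k.
Proof. by move=> le_ik; rewrite mdeg2 !expXYE !inordK //= subnK. Qed.

Lemma expXY_mdeg (k : nat) (m : 'X_{1..2}) :
  mdeg m = k -> m = expXY k (m (inord 1)).
Proof.
rewrite mdeg2 => <-; apply/mnmP => j; rewrite expXYE addnK.
by case: eqP => [j0|/eqP j1]; congr (m _); apply/val_inj; rewrite /= inordK //;
  case: j j0 || case: j j1; case=> [|[|]].
Qed.

Lemma expXY_inj (k : nat) : injective (expXY k).
Proof.
by move=> i j /(congr1 (fun m : 'X_{1..2} => m (inord 1))); rewrite !expXYE inordK.
Qed.

Section Forms.
Variable F : finFieldType.

Lemma monXYE (k i : nat) : monXY F k i = 'X_[expXY k i].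
Proof. by rewrite /monXY !mpolyXn mpolyXD. Qed.

Lemma mcoeff_monXY (k i j : nat) : (monXY F k i)@_(expXY k j) = (i == j)%:R.
Proof. by rewrite monXYE mcoeffX (inj_eq (@expXY_inj k)). Qed.

Lemma homog_expand (k : nat) (f : {mpoly F[2]}) : f \is k.-homog ->
  f = \sum_(i < k.+1) f@_(expXY k i) *: monXY F k i.
Proof.
move=> f_hom; apply/mpolyP => m; rewrite raddf_sum /=.
have [deg_m|deg_m] := eqVneq (mdeg m) k; last first.
  rewrite (dhomog_nemf_coeff f_hom deg_m) big1 // => i _.
  rewrite mcoeffZ monXYE mcoeffX; case: (expXY k i =P m) deg_m => [<-|]; last by rewrite mulr0.
  by rewrite mdeg_expXY ?eqxx //; apply: ltn_ord i.
have lt_mk : (m (inord 1) < k.+1)%N by rewrite ltnS -deg_m mdeg2 leq_addl.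
rewrite (expXY_mdeg deg_m) (bigD1 (Ordinal lt_mk)) //= mcoeffZ mcoeff_monXY eqxx.
rewrite mulr1 big1 ?addr0 // => i ne_i; rewrite mcoeffZ mcoeff_monXY.
by rewrite -val_eqE in ne_i; rewrite (negPf ne_i) mulr0.
Qed.

Lemma mem_lucas_space (p k : nat) (f : {mpoly F[2]}) : f \is k.-homog ->
  (['dhomog_k f] \in lucas_space F p k) <->
  (forall i, (i <= k)%N -> ~~ lucas_le p i k -> f@_(expXY k i) = 0).
Proof.
move=> f_hom; split=> [|f0].
  have fE : f = ['dhomog_k f] by rewrite insubdK.
  rewrite /lucas_space; set X := [seq _ | _ <- _ & _].
  move/(@coord_span _ _ _ (in_tuple X)) => f_span i le_ik nle.
  rewrite fE f_span (raddf_sum (@mpoly_of_dhomog 2 F k)) raddf_sum /= big1 // => s _.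
  rewrite mcoeffZ; have : X`_s \in X by rewrite mem_nth.
  case/mapP => j; rewrite mem_filter mem_iota ltnS => /andP[le_j le_jk] ->.
  rewrite insubdK ?mcoeff_monXY; last exact: monXY_homog.
  by case: eqP nle => [<-|_]; rewrite ?le_j ?mulr0.
have -> : ['dhomog_k f] =
    \sum_(i < k.+1) f@_(expXY k i) *: ['dhomog_k (monXY F k i)].
  apply/val_inj; rewrite /= (raddf_sum (@mpoly_of_dhomog 2 F k)) insubdK //=.
  rewrite {1}(homog_expand f_hom); apply: eq_bigr => i _.
  by rewrite insubdK //; apply: monXY_homog; rewrite -ltnS.
apply: rpred_sum => i _; have le_ik : (i <= k)%N by rewrite -ltnS.
have [le_i|nle_i] := boolP (lucas_le p i k); last by rewrite f0 // scale0r rpred0.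
apply/rpredZ/memv_span/map_f.
by rewrite mem_filter le_i mem_iota ltnS le_ik.
Qed.

Variables (L : fieldType) (emb : {rmorphism F -> L}).

(** Linear forms over [L] are used dehomogenised, as polynomials of degree at most 1; the pair [1],
    ['X] then reads off the coefficients of [f]. *)
Definition subst_form (l1 l2 : {poly L}) (f : {mpoly F[2]}) : {poly L} :=
  mmap (polyC \o emb) (fun j : 'I_2 => if j == 0 :> nat then l1 else l2) f.

Lemma subst_form_homog (k : nat) (f : {mpoly F[2]}) (l1 l2 : {poly L}) :
  f \is k.-homog ->
  subst_form l1 l2 f =
  \sum_(i < k.+1) emb f@_(expXY k i) *: (l1 ^+ (k - i) * l2 ^+ i).
Proof.
move=> f_hom; rewrite {1}(homog_expand f_hom) /subst_form raddf_sum /=.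
apply: eq_bigr => i _; rewrite mmapZ /= mul_polyC monXYE mmapX /mmap1.
by rewrite big_ord_recl big_ord1 !expXYE.
Qed.

Lemma coef_subst_form (k i : nat) (f : {mpoly F[2]}) :
  f \is k.-homog -> (i <= k)%N ->
  (subst_form 1 'X f)`_i = emb f@_(expXY k i).
Proof.
move=> f_hom le_ik; rewrite (subst_form_homog _ _ f_hom) coef_sum.
rewrite -ltnS in le_ik; rewrite (bigD1 (Ordinal le_ik)) //= coefZ.
rewrite expr1n mul1r coefXn eqxx mulr1 big1 ?addr0 // => j ne_j.
rewrite -val_eqE /= eq_sym in ne_j.
by rewrite coefZ expr1n mul1r coefXn (negPf ne_j) mulr0.
Qed.

Lemma subst_form_lucas (p k : nat) (f : {mpoly F[2]}) :
    p \in [pchar L] -> f \is k.-homog ->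
    (forall i, (i <= k)%N -> ~~ lucas_le p i k -> f@_(expXY k i) = 0) ->
  forall (a b c d : L) (j : nat), ~~ lucas_le p j k ->
  (subst_form (a%:P + b *: 'X) (c%:P + d *: 'X) f)`_j = 0.
Proof.
move=> pL f_hom f0 a b c d j nle_j; rewrite (subst_form_homog _ _ f_hom) coef_sum.
apply: big1 => i _; rewrite coefZ; have [le_i|nle_i] := boolP (lucas_le p i k).
  by rewrite (linear_powers_lucas pL) ?mulr0.
by rewrite f0 ?rmorph0 ?mul0r // -ltnS.
Qed.

Lemma subst_point_form (l1 l2 : {poly L}) (t : option F) :
  subst_form l1 l2 (point_form t) = if t is Some a then l1 - emb a *: l2 else l2.
Proof.
have sX (j : 'I_2) : subst_form l1 l2 'X_j = if j == 0 :> nat then l1 else l2.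
  by rewrite /subst_form mmapX mmap1U.
case: t => [a|] /=; last by rewrite sX inordK.
rewrite /subst_form raddfB /= mmapZ /= -/(subst_form _ _ _) -/(subst_form _ _ (varY F)).
by rewrite !sX !inordK //= mul_polyC.
Qed.

Lemma subst_set_form (l1 l2 : {poly L}) (S : {set option F}) :
  subst_form l1 l2 (set_form S) =
  \prod_(t in S) if t is Some a then l1 - emb a *: l2 else l2.
Proof.
rewrite /subst_form rmorph_prod; apply: eq_bigr => t _; exact: subst_point_form.
Qed.

End Forms.

(** * Elementary symmetric functions as coefficients, and their conjugates *)

Section ElementarySymmetric.
Variable L : finFieldType.

Lemma elem_symE (a : nat) (T : {set L}) :
  elem_sym a T =
  \sum_(h : {set 'I_#|T|} | #|h| == a) \prod_(i in h) enum_val i.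
Proof.
rewrite /elem_sym /mesym raddf_sum /=; apply: eq_bigr => h _.
by rewrite rmorph_prod /=; apply: eq_bigr => i _; rewrite mevalXU.
Qed.

Lemma coef_prod_elem_sym (a : nat) (T : {set L}) :
  (\prod_(u in T) (1 - u *: 'X))`_a = (-1) ^+ a * elem_sym a T.
Proof.
rewrite big_enum_val elem_symE.
(* With the linear term first, the expansion is indexed by the set [h] of factors that contribute
   it. *)
under eq_bigr do rewrite addrC.
rewrite bigA_distr coef_sum mulr_sumr [RHS]big_mkcond /=.
apply: eq_bigr => h _.
have -> : \prod_(i < #|T|) (if i \in h then - (enum_val i *: 'X) else 1) =
    ((-1) ^+ #|h| * \prod_(i in h) enum_val i) *: 'X^#|h|.
  rewrite -big_mkcond /= -[in RHS]prodr_const -[X in _ *: X]prodr_const.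
  rewrite -big_split /= -scaler_prod; apply: eq_bigr => i _.
  by rewrite mulN1r scaleNr.
by rewrite coefZ coefXn eq_sym; case: eqP => [->|_]; rewrite ?mulr1 ?mulr0.
Qed.

(* Conjugation [u |-> u ^+ q] inverts the elements of T, and
   [e_(n - a)(T) = e_n(T) * e_a(T^-1)]. *)
Lemma elem_sym_conj (q a : nat) (T : {set L}) :
    [pchar L].-nat q -> T \subset unity_set L q.+1 -> (a <= #|T|)%N ->
  elem_sym (#|T| - a) T = (\prod_(u in T) u) * elem_sym a T ^+ q.
Proof.
move=> q_pchar sTU le_a; have q_gt0 : (0 < q)%N by case/andP: q_pchar.
have card_compl (x y n : nat) :
    (x + y = n -> a <= n -> (y == n - a) = (x == a))%N by lia.
rewrite !elem_symE [\prod_(u in T) u]big_enum_val /=.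
rewrite (big_morph (fun x : L => x ^+ q) (fun x y => exprDn_pchar x y q_pchar)
  (expr0n _ q)) ?gtn_eqF //=.
rewrite mulr_sumr [LHS](reindex_inj (@setC_inj _)) /=.
apply: eq_big => [h | h _].
  by apply: card_compl => //; rewrite cardsC card_ord.
(* On [h] the factors pair up as [u * u ^+ q = 1]; the product over the complement of [h]
   remains. *)
rewrite [X in X * _](bigID [in h]) /= mulrAC -prodrXl -big_split /=.
rewrite [X in X * _]big1 ?mul1r => [|i _]; first by apply: eq_bigl => i; rewrite inE.
have /(subsetP sTU) := enum_valP i.
by rewrite inE -exprS => /andP[_ /eqP].
Qed.

End ElementarySymmetric.

(** * The Cayley transform and the blocks it carries to the unit circle *)

Section CayleyTransform.
Variables (F L : finFieldType) (emb : {rmorphism F -> L}) (xi : L).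
Hypotheses (card_L : #|L| = (#|F| ^ 2)%N) (F_pchar : [pchar L].-nat #|F|).
Hypothesis xi_notin : xi \notin codom emb.
Local Notation q := #|F|.
Local Notation kappa := (cayley emb xi).
Local Notation xi' := (xi ^+ q).

(** Over [F], [X^q - X] is the product of all [X - a], so its roots in [L] are the [emb a]. *)
Lemma fixed_in_base (x : L) : x ^+ q = x -> x \in codom emb.
Proof.
move=> fix_x.
have := congr1 (fun f => (map_poly emb f).[x]) (finField_genPoly F).
rewrite rmorphB rmorph_prod /= map_polyXn map_polyX !hornerE fix_x subrr.
rewrite horner_prod => /eqP; rewrite eq_sym prodf_seq_eq0 => /hasP[a _ /=].
by rewrite rmorphB /= map_polyX map_polyC !hornerE subr_eq0 => /eqP ->; apply: codom_f.
Qed.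

Lemma conj_conj (x : L) : x ^+ q ^+ q = x.
Proof. by rewrite -exprM mulnn -card_L expf_card. Qed.

Lemma conj_emb (a : F) : emb a ^+ q = emb a.
Proof. by rewrite -rmorphXn expf_card. Qed.

Lemma conjB (x y : L) : (x - y) ^+ q = x ^+ q - y ^+ q.
Proof. by apply/eqP; rewrite eq_sym subr_eq -exprDn_pchar // subrK. Qed.

Lemma xi_neq_conj : xi - xi' != 0.
Proof.
apply: contra xi_notin; rewrite subr_eq0 => /eqP fix_xi.
exact/fixed_in_base/esym.
Qed.

Lemma emb_sub_xi (a : F) : emb a - xi != 0.
Proof. by apply: contra xi_notin; rewrite subr_eq0 => /eqP <-; apply: codom_f. Qed.

Lemma emb_sub_conj (a : F) : emb a - xi' != 0.
Proof.
by have := expf_neq0 q (emb_sub_xi a); rewrite conjB conj_emb.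
Qed.

(** [kappa] is a Möbius map with nonzero determinant [xi - xi']. *)
Lemma cayley_inj : injective kappa.
Proof.
have cayley_neq1 a : kappa (Some a) <> 1.
  move/(canRL (divfK (emb_sub_conj a))); rewrite mul1r => /addrI/oppr_inj eq_xi.
  by have := xi_neq_conj; rewrite -eq_xi subrr eqxx.
move=> [a|] [b|] //=; last by move/esym/cayley_neq1.
  move/eqP; rewrite eqr_div ?emb_sub_conj // -subr_eq0.
  have -> : (emb a - xi) * (emb b - xi') - (emb b - xi) * (emb a - xi') =
            (emb a - emb b) * (xi - xi') by ring.
  rewrite mulf_eq0 (negPf xi_neq_conj) orbF subr_eq0 => /eqP/fmorph_inj -> //.
by move/cayley_neq1.
Qed.

(** Conjugation swaps the numerator and denominator of [kappa], hence inverts its value. *)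
Lemma cayley_unity (t : option F) : kappa t \in unity_set L q.+1.
Proof.
rewrite inE; case: t => [a|] /=; last by rewrite expr1n oner_eq0 eqxx.
rewrite mulf_neq0 ?invr_eq0 ?emb_sub_conj ?emb_sub_xi //= exprSr expr_div_n.
rewrite !conjB conj_conj conj_emb mulrA divfK ?emb_sub_xi //.
by rewrite divff ?emb_sub_conj.
Qed.

(** By counting: the image has [q + 1] elements, and [X^(q+1) - 1] has at most that many roots. *)
Lemma unity_set_cayley : unity_set L q.+1 = kappa @: [set: option F].
Proof.
apply/esym/eqP; rewrite eqEcard; apply/andP; split.
  by apply/subsetP => _ /imsetP[t _ ->]; apply: cayley_unity.
rewrite card_imset; last exact: cayley_inj.
rewrite cardsT card_option cardE max_unity_roots ?enum_uniq //.
by apply/allP => u; rewrite mem_enum inE => /andP[_]; rewrite unity_rootE.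
Qed.

Lemma subset_unity_cayley (T : {set L}) :
  T \subset unity_set L q.+1 -> exists S : {set option F}, T = kappa @: S.
Proof.
rewrite unity_set_cayley => sT; exists (kappa @^-1: T); apply/setP => u.
apply/idP/imsetP => [uT | [t]]; last by rewrite inE => ? ->.
by have /imsetP[t _ def_u] := subsetP sT u uT; exists t; rewrite // inE -def_u.
Qed.

(* With [U = X - xi Y] and [V = X - xi' Y] the form [U - kappa(t) V] is
   proportional to [X - t Y], so F_S and the form with root set kappa(S) are
   linear substitutions of one another. *)
Lemma lucas_space_cayley (p k : nat) (S : {set option F}) :
    p \in [pchar L] -> #|S| = k ->
  (['dhomog_k (set_form S)] \in lucas_space F p k) <->
  (forall i, (i <= k)%N -> ~~ lucas_le p i k ->
     (\prod_(u in kappa @: S) (1 - u *: 'X))`_i = 0).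
Proof.
move=> pL card_S; have S_hom : set_form S \is k.-homog.
  by rewrite -card_S; apply: set_form_homog.
rewrite (mem_lucas_space _ S_hom).
rewrite big_imset /=; last by move=> t s _ _; apply: cayley_inj.
have kappaE a : (emb a - xi') * kappa (Some a) = emb a - xi.
  by rewrite mulrC divfK ?emb_sub_conj.
split=> [S_lucas i le_ik nle_i | T_lucas i le_ik nle_i].
  (* Putting [X = xi' - xi Z] and [Y = 1 - Z] gives [U = xi' - xi] and [V = (xi' - xi) Z], so this
     inverts the passage to [U, V] up to a scalar. *)
  have := subst_form_lucas emb pL S_hom S_lucas xi' (- xi) 1 (- 1) nle_i.
  rewrite subst_set_form.
  pose c (t : option F) : L := if t is Some a then - (emb a - xi') else 1.
  rewrite (eq_bigr (fun t => c t *: (1 - kappa t *: 'X))) => [|[a|] _].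
  - rewrite scaler_prod coefZ => /eqP; rewrite mulf_eq0 => /orP[|/eqP//].
    rewrite prodf_seq_eq0 => /hasP[[a|] _ /andP[_]] /=; last by rewrite oner_eq0.
    by rewrite oppr_eq0 (negPf (emb_sub_conj a)).
  - by rewrite /c scalerBr scalerA mulNr kappaE -!mul_polyC; ring.
  - by rewrite scale1r !scale1r scaleN1r polyC1.
apply/(fmorph_inj emb); rewrite rmorph0 -(coef_subst_form emb S_hom le_ik).
(* The values of [kappa] lie in [L], so as points of the projective line over [L] they are all
   finite. *)
pose T := [set Some (kappa t) | t in S].
have inj_T : {in S &, injective (fun t => Some (kappa t))}.
  by move=> t s _ _ [/cayley_inj].
have T_hom : set_form T \is k.-homog.
  by rewrite -card_S -(card_in_imset inj_T); apply: set_form_homog.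
have T0 j : (j <= k)%N -> ~~ lucas_le p j k -> (set_form T)@_(expXY k j) = 0.
  move=> le_jk nle_j; rewrite -[LHS](coef_subst_form idfun T_hom le_jk).
  by rewrite subst_set_form big_imset //= T_lucas.
have := subst_form_lucas idfun pL T_hom T0 1 (- xi) 1 (- xi') nle_i.
rewrite !subst_set_form big_imset //=.
(* The scalars with [U - kappa(t) V = c(t) (X - t Y)]; at infinity [U - V = (xi' - xi) Y]. *)
pose c (t : option F) : L :=
  if t is Some a then (xi - xi') / (emb a - xi') else xi' - xi.
rewrite (eq_bigr (fun t => c t *: (if t is Some a then 1 - emb a *: 'X else 'X))).
  rewrite scaler_prod coefZ => /eqP; rewrite mulf_eq0 => /orP[|/eqP//].
  rewrite prodf_seq_eq0 => /hasP[[a|] _ /andP[_]] /=.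
    by rewrite mulf_eq0 invr_eq0 (negPf xi_neq_conj) (negPf (emb_sub_conj a)).
  by rewrite -oppr_eq0 opprB (negPf xi_neq_conj).
move=> [a|] _ /=; last by rewrite -!mul_polyC; ring.
apply: (scalerI (emb_sub_conj a)).
rewrite scalerA mulrCA divff ?emb_sub_conj // mulr1 scalerBr scalerA kappaE.
by rewrite -!mul_polyC; ring.
Qed.

(* For T in U_(q+1) the two coefficients [e_a] and [e_(k - a)] vanish together,
   so a single condition suffices when these are the only missing exponents. *)
Lemma cayley_blocks_lucas (p k a : nat) :
    p \in [pchar L] -> (a <= k)%N -> ~~ lucas_le p a k ->
    (forall i, (i <= k)%N -> i != a -> i != (k - a)%N -> lucas_le p i k) ->
  cayley_blocks emb xi (lucas_space F p k) =
  [set T : {set L} | [&& T \subset unity_set L q.+1, #|T| == k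
                       & elem_sym a T == 0]].
Proof.
move=> pL le_ak nle_a le_other; apply/setP => T; rewrite inE.
apply/imsetP/and3P => [[S] | [sTU /eqP card_T /eqP e_a]].
  rewrite inE => /andP[/eqP card_S /(lucas_space_cayley pL card_S) S_lucas ->].
  rewrite card_imset ?card_S ?eqxx; last exact: cayley_inj.
  split=> //; first by apply/subsetP => _ /imsetP[t _ ->]; apply: cayley_unity.
  have /eqP := S_lucas a le_ak nle_a.
  by rewrite coef_prod_elem_sym mulf_eq0 signr_eq0.
have [S def_T] := subset_unity_cayley sTU; exists S => //.
have card_S : #|S| = k by rewrite -card_T def_T card_imset //; exact: cayley_inj.
rewrite inE card_S eqxx; apply/(lucas_space_cayley pL card_S) => i le_ik nle_i.
rewrite -def_T coef_prod_elem_sym.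
have [->|ne_ia] := eqVneq i a; first by rewrite e_a mulr0.
have [->|ne_ika] := eqVneq i (k - a)%N; last by rewrite le_other in nle_i.
rewrite -card_T (elem_sym_conj F_pchar) ?card_T // e_a expr0n.
by rewrite gtn_eqF ?mulr0 // ltnW ?finNzRing_gt1.
Qed.

End CayleyTransform.

(** * The missing exponents in the four cases *)

Lemma lucas_le_two_digits (p i c d : nat) :
    (1 < p)%N -> (c < p)%N -> (d < p)%N -> (i <= c * p + d)%N ->
  lucas_le p i (c * p + d) = (i %% p <= d)%N.
Proof.
move=> p_gt1 lt_cp lt_dp le_i; have p_gt0 := ltnW p_gt1.
(* The size bound on [i] settles the upper digit, leaving only the last digit to compare. *)
have le_ic : (i %/ p <= c)%N by rewrite -ltnS ltn_divLR //; lia.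
rewrite lucas_le_rec // modnMDl divnMDl // (modn_small lt_dp) (divn_small lt_dp) addn0.
by rewrite lucas_le_small ?le_ic ?andbT // (leq_ltn_trans le_ic).
Qed.

(* The embedding emb presents L as the quadratic extension of F. *)
Theorem corollary2 (p m q : nat) (p_prime : prime p) (q_def : q = (p ^ m)%N)
    (F L : finFieldType) (card_F : #|F| = q) (card_L : #|L| = (q ^ 2)%N)
    (emb : {rmorphism F -> L}) (xi : L) (xi_notin : xi \notin codom emb)
    (k : nat) (k_bounds : (3 <= k <= q.+1)%N) :
  [/\ p = 2%N -> k = 5%N ->
        cayley_blocks emb xi (lucas_space F p k) =
        [set T : {set L} | [&& T \subset unity_set L q.+1, #|T| == 5%N
                             & elem_sym 2 T == 0]],
      odd p -> k = (2 * p - 3)%N ->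
        cayley_blocks emb xi (lucas_space F p k) =
        [set T : {set L} | [&& T \subset unity_set L q.+1,
                               #|T| == (2 * p - 3)%N & elem_sym (p - 2) T == 0]],
      odd p -> k = (2 * p - 2)%N ->
        cayley_blocks emb xi (lucas_space F p k) =
        [set T : {set L} | [&& T \subset unity_set L q.+1,
                               #|T| == (2 * p - 2)%N & elem_sym (p - 1) T == 0]]
    & odd p -> k = (3 * p - 2)%N ->
        cayley_blocks emb xi (lucas_space F p k) =
        [set T : {set L} | [&& T \subset unity_set L q.+1,
                               #|T| == (3 * p - 2)%N & elem_sym (p - 1) T == 0]]].
Proof.
have card_L' : #|L| = (#|F| ^ 2)%N by rewrite card_F.
have pL : p \in [pchar L].
  by apply: (card_finPcharP (n := (m * 2)%N)) => //; rewrite card_L q_def expnM.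
have F_pchar : [pchar L].-nat #|F|.
  by rewrite (eq_pnat _ (pcharf_eq pL)) card_F q_def pnatX pnat_id.
have blocksE := cayley_blocks_lucas card_L' F_pchar xi_notin pL.
rewrite card_F in blocksE.
have p_gt1 := prime_gt1 p_prime.
split=> [p2 | p_odd | p_odd | p_odd] k_def; rewrite -k_def.
(* In binary 5 is 101, so exactly 2 and 3 = 5 - 2 are missing. *)
- apply: blocksE; rewrite k_def ?p2 //.
    by rewrite lucas_le_rec // lucas_le_rec // lucas_le_small.
  by case=> [|[|[|[|[|[|i]]]]]] // *; rewrite lucas_le_rec // lucas_le_rec // lucas_le_small.
all: have p_gt2 := odd_prime_gt2 p_odd p_prime.
(* Last digits [p - 2] and [p - 1] are excluded; up to [k] they occur only at [p - 2] and [p - 1],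
   whose sum is [k]. *)
- have {}k_def : k = (1 * p + (p - 3))%N by lia.
  apply: blocksE => [||i le_ik ne1 ne2]; first by lia.
    by rewrite k_def lucas_le_two_digits ?modn_small; lia.
  rewrite k_def lucas_le_two_digits -?k_def; try lia.
  have := divn_eq i p; have := ltn_pmod i (ltnW p_gt1).
  by case: (i %/ p)%N => [|[|n]]; rewrite ?mulSn; lia.
(* Only [p - 1] is missing, and it is its own complement in [k]. *)
- have {}k_def : k = (1 * p + (p - 2))%N by lia.
  apply: blocksE => [||i le_ik ne1 ne2]; first by lia.
    by rewrite k_def lucas_le_two_digits ?modn_small; lia.
  rewrite k_def lucas_le_two_digits -?k_def; try lia.
  have := divn_eq i p; have := ltn_pmod i (ltnW p_gt1).
  by case: (i %/ p)%N => [|[|n]]; rewrite ?mulSn; lia.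
(* Last digit [p - 1] is excluded: up to [k] this means [p - 1] and [2 * p - 1], whose sum is
   [k]. *)
have {}k_def : k = (2 * p + (p - 2))%N by lia.
apply: blocksE => [||i le_ik ne1 ne2]; first by lia.
  by rewrite k_def lucas_le_two_digits ?modn_small; lia.
rewrite k_def lucas_le_two_digits -?k_def; try lia.
have := divn_eq i p; have := ltn_pmod i (ltnW p_gt1).
by case: (i %/ p)%N => [|[|[|n]]]; rewrite ?mulSn; lia.
Qed.
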